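(* (i) For integers $k\ge1$, $m\ge0$, the Jones polynomial of the Montesinos link $M_{[k[\frac25],m[\frac12]]}$ (with any orientation) satisfies $$V_{M_{[k[\frac25],m[\frac12]]}}(t)\ \doteq\ (1+t^2)(1-t^2)^{k-1}(1-t)^m .$$ (ii) If additionally $k+m\ge2$, then $V_{M_{[k[\frac25],m[\frac12]]}}(t)\doteq(1+t)^{k-1}(1-t)^{k+m-2}$.
   Context: Conway notation for 2-tangles: $[\frac pq]$ is the rational tangle with fraction $p/q$; the numerator $T^N$ joins NW–NE and SW–SE outside the ball; $T_A*T_B$ places $T_A$ left of $T_B$ joining NE of $T_A$ to NW of $T_B$ and SE to SW. $M_{[k[\frac25],m[\frac12]]}=([\frac25]*\cdots*[\frac25]*[\frac12]*\cdots*[\frac12])^N$ with $k$ factors $[\frac25]$ and $m$ factors $[\frac12]$. Let $I_t$ be the ideal of $\mathbb Z[t^{\pm1/2}]$ generated by $\frac{t^5+1}{t+1}=t^4-t^3+t^2-t+1$. For $f,g\in\mathbb Z[t^{\pm1/2}]$ write $f\doteq g$ if $f\equiv \pm t^{i/2}g \pmod{I_t}$ for some sign and some integer $i$. *)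

(* Defs.v *)
From HB Require Import structures.
From mathcomp Require Import all_boot all_order all_algebra.
From mathcomp Require Import fraction.
Unset Printing Implicit Defensive.
Import Order.TTheory GRing.Theory Num.Theory.

(* Diagrams.  Labels are nats.  A crossing (a,b,c,d) lists the four edge
   labels around the crossing COUNTERCLOCKWISE, the under-strand being a--c
   and the over-strand b--d.  An arc (x,y) is a crossingless segment
   joining label x to label y.  In a closed diagram every label occurs
   exactly twice.  All labels are < dbnd.                                  *)
Definition crossing := (nat * nat * nat * nat)%type.
Definition arc := (nat * nat)%type.

Record diagram := Diagram {
  dcross : seq crossing;
  darcs  : seq arc;
  dbnd   : nat }.

Record tangle := Tangle {
  tcross : seq crossing;
  tarcs  : seq arc;
  tnw : nat; tne : nat; tsw : nat; tse : nat;
  tbnd : nat }.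

Definition shift_cr (n : nat) (x : crossing) : crossing :=
  let: (a, b, c, d) := x in (a + n, b + n, c + n, d + n).
Definition shift_arc (n : nat) (x : arc) : arc := let: (a, b) := x in (a + n, b + n).

Definition tshift (n : nat) (T : tangle) : tangle :=
  Tangle (map (shift_cr n) (tcross T)) (map (shift_arc n) (tarcs T))
         (tnw T + n) (tne T + n) (tsw T + n) (tse T + n) (tbnd T + n).

(* The elementary crossing tangle [1] (under-strand SW--NE; counterclockwise
   order of the corners is SW, SE, NE, NW). *)
Definition tangle1 : tangle := Tangle [:: (0, 1, 2, 3)] [::] 3 2 0 1 4.

Definition tangle0 : tangle := Tangle [::] [:: (0, 1); (2, 3)] 0 1 2 3 4.

Definition tprod (TA TB : tangle) : tangle :=
  let TB' := tshift (tbnd TA) TB in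
  Tangle (tcross TA ++ tcross TB')
         (tarcs TA ++ tarcs TB' ++ [:: (tne TA, tnw TB'); (tse TA, tsw TB')])
         (tnw TA) (tne TB') (tsw TA) (tse TB') (tbnd TB').

(* Vertical sum: T1 on top of T2, joining SW of T1 to NW of T2 and SE of T1
   to NE of T2.  (Fractions: 1/F(T1 vsum T2) = 1/F(T1) + 1/F(T2).) *)
Definition tvsum (T1 T2 : tangle) : tangle :=
  let T2' := tshift (tbnd T1) T2 in
  Tangle (tcross T1 ++ tcross T2')
         (tarcs T1 ++ tarcs T2' ++ [:: (tsw T1, tnw T2'); (tse T1, tne T2')])
         (tnw T1) (tne T1) (tsw T2') (tse T2') (tbnd T2').

Definition numerator (T : tangle) : diagram :=
  Diagram (tcross T) (tarcs T ++ [:: (tnw T, tne T); (tsw T, tse T)]) (tbnd T).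

(* Rational tangles: [2] = [1]*[1], [1/2] = [1] vsum [1] (vertical twist),
   [2/5] = [1/2] vsum [2]  (since 5/2 = 2 + 1/2). *)
Definition tangle_2 : tangle := tprod tangle1 tangle1.
Definition tangle_1_2 : tangle := tvsum tangle1 tangle1.
Definition tangle_2_5 : tangle := tvsum tangle_1_2 tangle_2.

Definition tprod_seq (ts : seq tangle) : tangle :=
  if ts is t :: ts' then foldl tprod t ts' else tangle0.

Definition montesinos_2_5_1_2 (k m : nat) : diagram :=
  numerator (tprod_seq (nseq k tangle_2_5 ++ nseq m tangle_1_2)).

(* Laurent polynomials live in the field of fractions of Z[A]. *)
Definition LF := {fraction {poly int}}.
Definition tof (p : {poly int}) : LF := @FracField.tofrac _ p.
Definition varA : LF := tof 'X.

Local Open Scope ring_scope.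

(* Kauffman bracket: A-smoothing of (a,b,c,d) gives arcs a--b, c--d
   (joining the two regions swept by the over-strand turning
   counterclockwise); B-smoothing gives a--d, b--c. *)
Definition smooth (sA : bool) (x : crossing) : seq arc :=
  let: (a, b, c, d) := x in
  if sA then [:: (a, b); (c, d)] else [:: (a, d); (b, c)].

Definition cr_labels (x : crossing) : seq nat :=
  let: (a, b, c, d) := x in [:: a; b; c; d].
Definition arc_labels (x : arc) : seq nat := let: (a, b) := x in [:: a; b].

Definition dlabels (D : diagram) : seq nat :=
  flatten (map cr_labels (dcross D)) ++ flatten (map arc_labels (darcs D)).

Definition x0cr : crossing := (0, 0, 0, 0)%N.

Definition state_arcs (D : diagram) (s : {ffun 'I_(size (dcross D)) -> bool}) : seq arc :=
  darcs D ++ flatten [seq smooth (s i) (nth x0cr (dcross D) i) | i <- enum 'I_(size (dcross D))].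

Definition arc_rel (E : seq arc) (N : nat) : rel 'I_N :=
  fun x y => ((val x, val y) \in E) || ((val y, val x) \in E).

Definition nloops (D : diagram) (s : {ffun 'I_(size (dcross D)) -> bool}) : nat :=
  n_comp (arc_rel (state_arcs D s) (dbnd D))
         [pred x : 'I_(dbnd D) | val x \in dlabels D].

Definition nA (n : nat) (s : {ffun 'I_n -> bool}) : nat := #|[pred i | s i]|.
Definition nB (n : nat) (s : {ffun 'I_n -> bool}) : nat := #|[pred i | ~~ s i]|.

Definition loopd : LF := - varA ^+ 2 - varA ^- 2.

Definition kbracket (D : diagram) : LF :=
  \sum_(s : {ffun 'I_(size (dcross D)) -> bool})
     varA ^ ((nA _ s)%:Z - (nB _ s)%:Z) * loopd ^ ((nloops D s)%:Z - 1).

(* Orientations: for the i-th crossing a pair (u, v): u = under-strand runs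
   a -> c (else c -> a), v = over-strand runs b -> d (else d -> b); for the
   j-th arc (x,y) a bit: runs x -> y (else y -> x). *)
Record orientation := Orientation { ocross : seq (bool * bool); oarcs : seq bool }.

Definition cr_starts (x : crossing) (o : bool * bool) : seq nat :=
  let: (a, b, c, d) := x in [:: if o.1 then a else c; if o.2 then b else d].
Definition cr_ends (x : crossing) (o : bool * bool) : seq nat :=
  let: (a, b, c, d) := x in [:: if o.1 then c else a; if o.2 then d else b].
Definition arc_start (x : arc) (o : bool) : nat := let: (a, b) := x in if o then a else b.
Definition arc_end (x : arc) (o : bool) : nat := let: (a, b) := x in if o then b else a.

Definition ostarts (D : diagram) (O : orientation) : seq nat :=
  flatten [seq cr_starts xo.1 xo.2 | xo <- zip (dcross D) (ocross O)]
  ++ [seq arc_start xo.1 xo.2 | xo <- zip (darcs D) (oarcs O)].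
Definition oends (D : diagram) (O : orientation) : seq nat :=
  flatten [seq cr_ends xo.1 xo.2 | xo <- zip (dcross D) (ocross O)]
  ++ [seq arc_end xo.1 xo.2 | xo <- zip (darcs D) (oarcs O)].

Definition valid_orientation (D : diagram) (O : orientation) : Prop :=
  size (ocross O) = size (dcross D) /\ size (oarcs O) = size (darcs D) /\
  forall l, l \in dlabels D ->
    count_mem l (ostarts D O) = 1%N /\ count_mem l (oends D O) = 1%N.

(* crossing sign: with under a->c and over b->d (a,b,c,d counterclockwise)
   the crossing is negative. *)
Definition cr_sign (o : bool * bool) : int := if o.1 == o.2 then -1 else 1.

Definition writhe (D : diagram) (O : orientation) : int :=
  \sum_(i < size (dcross D)) cr_sign (nth (true, true) (ocross O) i).

(* V_D(t) = (-A^3)^(-w(D)) <D>, with A = t^(-1/4). *)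
Definition jones (D : diagram) (O : orientation) : LF :=
  (- varA ^+ 3) ^ (- writhe D O) * kbracket D.

Definition tsqrt : LF := varA ^ (-2).
Definition tvar : LF := varA ^ (-4).

(* Z[t^(±1/2)] = { q(t^(1/2)) / t^(n/2) } = { q(A^2)... } : we use
   elements  tof (q \Po 'X^2) / A^(2n)  = q(A^2) A^(-2n) with q in Z[X]. *)
Definition in_Zt (h : LF) : Prop :=
  exists (q : {poly int}) (n : nat), h = tof (q \Po 'X^2) / varA ^+ (2 * n).

(* generator of I_t: (t^5+1)/(t+1) = t^4 - t^3 + t^2 - t + 1 *)
Definition gen_It : LF := tvar ^+ 4 - tvar ^+ 3 + tvar ^+ 2 - tvar + 1.

Definition doteq (f g : LF) : Prop :=
  exists (eps : bool) (i : int) (h : LF),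
    in_Zt h /\ f - (-1) ^+ eps * tsqrt ^ i * g = h * gen_It.

(* Main.v *)
(* The Kauffman bracket is evaluated tangle by tangle. Each tangle T equals a[0] + b[oo] in every
   surrounding diagram, where two moves on crossingless diagrams suffice: contracting a vertex of
   a path and removing an isolated loop, the latter at the cost of a factor d = - A^2 - A^-2.
   Horizontal gluing gives (a, b) * (a', b') = (a a', a b' + b a' + d b b'), so that a and a + d b
   are multiplicative, and the numerator closure has bracket a d + b.

   For [2/5], with coefficients (x, y), x + d y is the bracket of the denominator closure, the
   figure-eight knot, and lies in I_t. Hence, mod I_t, a product having a factor [2/5] is
   (x r, y r), with r the product of the other first coefficients, and its numerator has bracket (x d + y) r.
   Here x d + y, the bracket of the Hopf link, x, and the first coefficient of [1/2] are, up to
   monomials, 1 + t^2, 1 - t^2 (mod I_t) and 1 - t.  The second formula follows from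
   (1 + t^2)(1 - t) = 1 - t + t^2 - t^3 = - t^4 mod I_t. The number of crossings is even,
   hence so is the writhe, and the writhe factor is a monomial in t^(1/2) for any orientation. *)

Require Import Defs.
From HB Require Import structures.
From mathcomp Require Import all_boot all_order all_algebra.
From mathcomp Require Import fraction.
From mathcomp Require Import ring zify.
Import Order.TTheory GRing.Theory Num.Theory.
Local Open Scope ring_scope.
Set Implicit Arguments.
Unset Strict Implicit.

(** * Components of crossingless diagrams *)

(** [arc_rel] on bare labels: lists of arcs can be compared up to order and direction with no bound
    on the labels. *)
Definition adj (E : seq Defs.arc) (x y : nat) : bool := ((x, y) \in E) || ((y, x) \in E).

Definition alabels (E : seq Defs.arc) : seq nat := flatten (map arc_labels E).

Definition ncomp (N : nat) (E : seq Defs.arc) : nat :=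
  n_comp (arc_rel E N) [pred x : 'I_N | val x \in alabels E].

(** In this normalisation a single loop has weight 1 and the empty list of arcs has weight
    [loopd^-1]. *)
Definition loop_weight (N : nat) (E : seq Defs.arc) : LF := loopd ^ ((ncomp N E)%:Z - 1).

Lemma adjC E x y : adj E x y = adj E y x.
Proof. by rewrite /adj orbC. Qed.

Lemma alabelsP E x : reflect (exists y, adj E x y) (x \in alabels E).
Proof.
apply: (iffP flatten_mapP) => [[[u v] uvE]|[y /orP[]xyE]].
- rewrite !inE => /orP[]/eqP->; [exists v|exists u]; by rewrite /adj uvE ?orbT.
- by exists (x, y) => //; rewrite !inE eqxx.
- by exists (y, x) => //; rewrite !inE eqxx orbT.
Qed.

Lemma alabels_cat E F : alabels (E ++ F) = alabels E ++ alabels F.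
Proof. by rewrite /alabels map_cat flatten_cat. Qed.

Lemma adj_cat E F x y : adj (E ++ F) x y = adj E x y || adj F x y.
Proof. by rewrite /adj !mem_cat orbACA. Qed.

Lemma adj_cons a E x y :
  adj (a :: E) x y = [|| (x, y) == a, (y, x) == a | adj E x y].
Proof. by rewrite /adj !in_cons orbACA !orbA. Qed.

Lemma adj_catCA E F G : adj (E ++ F ++ G) =2 adj (F ++ E ++ G).
Proof. by move=> x y; rewrite !adj_cat orbCA. Qed.

Lemma arc_rel_sym E N : symmetric (arc_rel E N).
Proof. by move=> x y; apply: adjC. Qed.

Lemma connect_arc_sym E N : connect_sym (arc_rel E N).
Proof. exact/sym_connect_sym/arc_rel_sym. Qed.

Lemma eq_alabels E F : adj E =2 adj F -> alabels E =i alabels F.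
Proof.
by move=> EF x; apply/alabelsP/alabelsP => -[y xy]; exists y; move: xy; rewrite EF.
Qed.

Lemma eq_ncomp N E F : adj E =2 adj F -> ncomp N E = ncomp N F.
Proof.
move=> EF; rewrite /ncomp.
rewrite (@eq_n_comp _ _ (arc_rel F N)); last first.
  by apply: eq_connect => x y; apply: EF.
by apply: eq_n_comp_r => x; rewrite !inE (eq_alabels EF).
Qed.

Lemma eq_loop_weight N E F : adj E =2 adj F -> loop_weight N E = loop_weight N F.
Proof. by move=> EF; rewrite /loop_weight (eq_ncomp N EF). Qed.

(** The retraction sending [y] to [x] preserves and reflects connectivity, so it is an adjunction
    and keeps the number of components. The case [x = z] is allowed and yields the loop [(x, x)]. *)
Lemma ncomp_contract N E x y z :
    (x < N)%N -> (y < N)%N -> (z < N)%N -> y != x -> y != z -> y \notin alabels E ->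
  ncomp N [:: (x, y), (y, z) & E] = ncomp N ((x, z) :: E).
Proof.
move=> xN yN zN yx yz yE; rewrite /ncomp.
set big := _ :: _ :: _; set small := _ :: _.
pose ox := Ordinal xN; pose oy := Ordinal yN; pose oz := Ordinal zN.
pose h (u : 'I_N) := if u == oy then ox else u.
have yS : y \notin alabels small by rewrite !inE (negPf yx) (negPf yz).
have adjy u v : adj small u v -> (u != y) && (v != y).
  move=> uv; apply/andP; split; apply: contraNneq yS => <-; apply/alabelsP.
    by exists v.
  by exists u; rewrite adjC.
have symB := @connect_arc_sym big N; have symS := @connect_arc_sym small N.
have oE (o : 'I_N) l (lN : (l < N)%N) : val o = l -> o = Ordinal lN.
  by move=> ol; apply: val_inj.
have hB u : connect (arc_rel big N) u (h u).
  rewrite /h; case: eqP => // ->; rewrite symB; apply: connect1.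
  by rewrite /arc_rel /= !inE eqxx.
(* The arc [(x, z)] of [small] is traced in [big] through [y]. *)
have SB u v : connect (arc_rel small N) u v -> connect (arc_rel big N) u v.
  apply: connect_sub => {}u {}v; rewrite /arc_rel -/(adj _ _ _) adj_cons.
  have cxz : connect (arc_rel big N) ox oz.
    apply: (@connect_trans _ _ oy); apply: connect1;
    by rewrite /arc_rel /= !inE eqxx ?orbT.
  case/or3P => [/eqP[ux vz]|/eqP[vx uz]|uv].
  - by rewrite (oE _ _ xN ux) (oE _ _ zN vz).
  - by rewrite (oE _ _ zN uz) (oE _ _ xN vx) symB.
  - by apply: connect1; rewrite /arc_rel -/(adj _ _ _) !adj_cons uv !orbT.
(* Along a path of [big], an arc [x]-[y] collapses to a point and an arc [y]-[z] becomes [x]-[z]. *)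
have BS u v : connect (arc_rel big N) u v -> connect (arc_rel small N) (h u) (h v).
  case/connectP => p; elim: p u => [|w p IH] u /=; first by move=> _ ->.
  case/andP => uw pw vE; apply: connect_trans (IH _ pw vE).
  have hx : h ox = ox by rewrite /h; case: eqP.
  have hy : h oy = ox by rewrite /h eqxx.
  have hz : h oz = oz by rewrite /h; case: eqP => // -[] zy; rewrite zy eqxx in yz.
  have cxz : connect (arc_rel small N) ox oz.
    by apply: connect1; rewrite /arc_rel /= !inE eqxx.
  move: uw; rewrite /arc_rel -/(adj _ _ _) !adj_cons.
  case/or4P => [/eqP[ua wa]|/eqP[wa ua]|/eqP[ua wa]|].
  - by rewrite (oE _ _ xN ua) (oE _ _ yN wa) -/ox -/oy hx hy.
  - by rewrite (oE _ _ yN ua) (oE _ _ xN wa) -/ox -/oy hx hy.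
  - by rewrite (oE _ _ yN ua) (oE _ _ zN wa) -/oz -/oy hz hy.
  case/orP=> [/eqP[wa ua]|uw].
  - by rewrite (oE _ _ yN wa) (oE _ _ zN ua) -/oz -/oy hz hy symS.
  have uwS : adj small u w by rewrite adj_cons uw !orbT.
  case/andP: (adjy _ _ uwS) => uy wy.
  rewrite /h -!val_eqE /= (negPf uy) (negPf wy).
  by apply: connect1.
symmetry.
rewrite (@adjunction_n_comp _ _ h (arc_rel small N) (arc_rel big N)) //.
- apply: eq_n_comp_r => u; rewrite !inE /= /h -val_eqE /=.
  case: (eqVneq (val u) y) => [->|uy] /=; first by rewrite !eqxx !orbT.
  by case: (val u == x); case: (val u == z).
- apply: intro_closed => // u v; rewrite /arc_rel -/(adj _ _ _) => uv _.
  by rewrite inE; apply/alabelsP; exists u; rewrite adjC.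
- split=> [u uS|u' v' _].
    exists u; rewrite /h; case: eqP => // uy; case/negP: yS.
    by move: uS; rewrite inE uy.
  apply/idP/idP => [/BS//|/SB huv].
  by apply: connect_trans (hB _) (connect_trans huv _); rewrite symB.
Qed.

(** The loop creates no new connection; it only adds [x], a component by itself, to the labels that
    are counted. *)
Lemma ncomp_loop N E x : (x < N)%N -> x \notin alabels E ->
  ncomp N ((x, x) :: E) = (ncomp N E).+1.
Proof.
move=> xN xE; rewrite /ncomp; pose ox := Ordinal xN.
have econn : connect (arc_rel ((x, x) :: E) N) =2 connect (arc_rel E N).
  move=> u v; apply/idP/idP; apply: connect_sub => {}u {}v;
    rewrite /arc_rel -!/(adj _ _ _) ?adj_cons.
    case/or3P => [/eqP[ux vx]|/eqP[ux vx]|uv].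
    + by have -> : u = v by apply: val_inj; rewrite /= ux vx.
    + by have -> : u = v by apply: val_inj; rewrite /= ux vx.
    + exact: connect1.
  by move=> uv; apply: connect1; rewrite /arc_rel -/(adj _ _ _) adj_cons uv !orbT.
rewrite (eq_n_comp econn) -[RHS]add1n /n_comp_mem.
(* No arc of [E] leaves [x], so [x] is its own root. *)
have rx : fingraph.root (arc_rel E N) ox = ox.
  have /connectP[[|v p] /= ]: connect (arc_rel E N) ox (fingraph.root (arc_rel E N) ox).
  - exact: connect_root.
  - by move=> _ ->.
  - case/andP => xv; case/negP: xE; apply/alabelsP; exists v; exact: xv.
rewrite (cardD1 ox); congr (_ + _)%N.
  by rewrite !inE /= eqxx /roots rx eqxx.
apply: eq_card => u; rewrite [LHS]inE [X in _ && X]inE [RHS]inE; apply/andP/andP.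
- case=> ux /andP[ru]; rewrite /= !inE => /or3P[/eqP uE|/eqP uE|uE].
  + by case/negP: ux; apply/eqP/val_inj.
  + by case/negP: ux; apply/eqP/val_inj.
  + by split; rewrite ?inE.
- case=> ru /= uE; split.
    by apply: contraNneq xE => uo; move: uE; rewrite uo.
  by rewrite ru; apply/orP; right; apply/orP; right; exact: uE.
Qed.

(** * State sums and local skein evaluations *)

Lemma varA_neq0 : varA != 0.
Proof. by rewrite /varA /tof tofrac_eq0 polyX_eq0. Qed.

(** [loopd] is [-(A^4 + 1) / A^2], and [X^4 + 1] is a nonzero polynomial. Invertibility matters
    because loop weights involve the exponent -1. *)
Lemma loopd_neq0 : loopd != 0.
Proof.
have dE (F : fieldType) (a : F) : a != 0 -> - a ^+ 2 - a ^- 2 = - ((a ^+ 4 + 1) / a ^+ 2).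
  by move=> a0; field.
rewrite /loopd (dE _ _ varA_neq0) oppr_eq0.
apply: mulf_neq0; last by rewrite invr_eq0 expf_neq0 // varA_neq0.
have -> : varA ^+ 4 + 1 = tof ('X^4 + 1) by rewrite /tof tofracD tofracXn tofrac1.
by rewrite /tof tofrac_eq0 -[1]/(1%:P) -size_poly_eq0 size_XnaddC.
Qed.

(** [F] is given only up to adjacency, so the path to be contracted need not stand at the head of
    the list. *)
Lemma loop_weight_contract N E F x y z :
    (x < N)%N -> (y < N)%N -> (z < N)%N -> y != x -> y != z -> y \notin alabels E ->
    adj F =2 adj [:: (x, y), (y, z) & E] ->
  loop_weight N F = loop_weight N ((x, z) :: E).
Proof.
move=> xN yN zN yx yz yE /eq_loop_weight->.
by rewrite /loop_weight ncomp_contract.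
Qed.

Lemma loop_weight_loop N E F x : (x < N)%N -> x \notin alabels E ->
    adj F =2 adj ((x, x) :: E) ->
  loop_weight N F = loopd * loop_weight N E.
Proof.
move=> xN xE /eq_loop_weight->; rewrite /loop_weight ncomp_loop //.
by rewrite -{2}(expr1z loopd) -expfzDr ?loopd_neq0 //; congr (_ ^ _); lia.
Qed.

(** The value [f] of a fully smoothed diagram is arbitrary, so that the state sum of one tangle can
    serve as the value in that of another. *)
Fixpoint state_sum (cs : seq crossing) (f : seq Defs.arc -> LF) (E : seq Defs.arc) : LF :=
  if cs is x :: cs' then
    varA * state_sum cs' f (smooth true x ++ E)
    + varA^-1 * state_sum cs' f (smooth false x ++ E)
  else f E.

Lemma state_sum_cat cs cs' f E :
  state_sum (cs ++ cs') f E = state_sum cs (state_sum cs' f) E.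
Proof. by elim: cs E => //= x cs IH E; rewrite !IH. Qed.

Lemma state_sum_linear cs f g a b E :
  state_sum cs (fun E => a * f E + b * g E) E
  = a * state_sum cs f E + b * state_sum cs g E.
Proof. 
elim: cs E => //= x cs IH E; rewrite !IH !mulrDr addrACA.
by rewrite !(mulrCA varA) !(mulrCA varA^-1).
 Qed.

Definition crlabels (cs : seq crossing) : seq nat := flatten (map cr_labels cs).

Lemma smooth_labels b x : alabels (smooth b x) =i cr_labels x.
Proof.
move: x => [[[i j] k] l] n; case: b; rewrite /alabels /= !inE //.
by case: (n == i); case: (n == j); case: (n == k); case: (n == l).
Qed.

(** Smoothings only add arcs between labels of [cs]. This permits the use of a skein evaluation,
    valid only for diagrams that avoid the interior of its tangle, inside another state sum. *)
Lemma eq_state_sum_on cs f g E :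
    (forall S, {subset alabels S <= crlabels cs} -> f (S ++ E) = g (S ++ E)) ->
  state_sum cs f E = state_sum cs g E.
Proof.
elim: cs E => /= [|x cs IH] E fg; first exact: (fg [::]).
have fgb b : state_sum cs f (smooth b x ++ E) = state_sum cs g (smooth b x ++ E).
  apply: IH => S S_cs; rewrite !catA; apply: fg => l.
  rewrite alabels_cat /crlabels /= !mem_cat smooth_labels => /orP[/S_cs|->//].
  by move->; rewrite orbT.
by rewrite !fgb.
Qed.

Definition adj_invariant (f : seq Defs.arc -> LF) : Prop :=
  forall E F, adj E =2 adj F -> f E = f F.

Lemma loop_weight_invariant N : adj_invariant (loop_weight N).
Proof. by move=> E F; apply: eq_loop_weight. Qed.

Lemma state_sum_invariant cs f : adj_invariant f -> adj_invariant (state_sum cs f).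
Proof.
move=> finv; elim: cs => [|x cs IH] E F EF /=; first exact: finv.
by congr (_ * _ + _ * _); apply: IH => u v; rewrite !adj_cat EF.
Qed.

Lemma state_sum_prefix cs f Z E : adj_invariant f ->
  state_sum cs (fun F => f (Z ++ F)) E = state_sum cs f (Z ++ E).
Proof.
move=> finv; elim: cs E => //= x cs IH E.
by rewrite !IH; congr (_ * _ + _ * _); apply: state_sum_invariant (adj_catCA _ _ _).
Qed.

(* Local skein evaluation: the tangle with crossings [cs], arcs [es] and corner labels p = NW,
   q = NE, r = SW, s = SE equals a[0] + b[oo] in every diagram that meets it only at its corners. *)
Definition skein_eval (cs : seq crossing) (es : seq Defs.arc) (lo hi p q r s : nat)
    (a b : LF) : Prop :=
  forall N E, (hi <= N)%N ->
    {in alabels E, forall l, (lo <= l < hi)%N -> l \in [:: p; q; r; s]} ->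
  state_sum cs (loop_weight N) (es ++ E)
  = a * loop_weight N [:: (p, q), (r, s) & E] + b * loop_weight N [:: (p, r), (q, s) & E].

(** Half-open ranges: two tangles with consecutive ranges have disjoint labels. *)
Definition well_labelled (cs : seq crossing) (es : seq Defs.arc) (lo hi p q r s : nat) : Prop :=
  uniq [:: p; q; r; s]
  /\ {in [:: p; q; r; s] ++ crlabels cs ++ alabels es, forall l, (lo <= l < hi)%N}.

(** Exchanging NE with SW turns [0] into [oo] and conversely. *)
Lemma skein_evalC cs es lo hi p q r s a b :
  skein_eval cs es lo hi p q r s a b -> skein_eval cs es lo hi p r q s b a.
Proof.
move=> ev N E hiN avE; rewrite ev // 1?addrC // => l lE /(avE l lE).
by rewrite !inE orbCA; do 4 case: (l == _).
Qed.

Lemma well_labelledC cs es lo hi p q r s :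
  well_labelled cs es lo hi p q r s -> well_labelled cs es lo hi p r q s.
Proof.
case=> u lab; split.
  by move: u; rewrite /= !inE (eq_sym r q) !negb_or -!andbA; do 6 case: eqP => //=.
move=> l ll; apply: lab; move: ll; rewrite !mem_cat !inE.
by do 4 case: (l == _).
Qed.

Lemma eq_adj E F :
  (forall a, a \in E -> adj F a.1 a.2) -> (forall a, a \in F -> adj E a.1 a.2) ->
  adj E =2 adj F.
Proof.
have sub G H u v : (forall a, a \in G -> adj H a.1 a.2) -> adj G u v -> adj H u v.
  by move=> GH /orP[/GH|/GH] //=; rewrite adjC.
by move=> EF FE u v; apply/idP/idP; apply: sub.
Qed.

Lemma alabels_cons x y E l :
  (l \in alabels ((x, y) :: E)) = [|| l == x, l == y | l \in alabels E].
Proof. by rewrite /alabels /= !inE. Qed.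

Ltac adj_tac := apply: eq_adj => -[u v]; rewrite ?(in_cons, mem_cat, in_nil, orbF);
  let H := fresh in move=> H;
  repeat (case/orP: H => H; first (case/eqP: H => -> ->;
    by rewrite /adj /= ?(in_cons, mem_cat, eqxx, orbT)));
  first [by rewrite /adj /= ?(in_cons, mem_cat) H ?orbT
    | case/eqP: H => -> ->; by rewrite /adj /= ?(in_cons, mem_cat, eqxx, orbT)].

Ltac split_andb := let H := fresh in move=> H; repeat (case/andP: H => ? H); try clear H.

Ltac neq_tac := solve [exact: isT | assumption | rewrite eq_sym; assumption].
Ltac notin_tac := rewrite ?alabels_cons; repeat (apply/norP; split); neq_tac.

(** Replaces the path [x]-[y]-[z] by the arc [x]-[z]; [rest] lists the other arcs of the diagram. *)
Ltac contract x y z rest :=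
  rewrite (@loop_weight_contract _ rest _ x y z);
  [ | assumption | assumption | assumption | neq_tac | neq_tac | notin_tac | adj_tac].

(** * Joining two crossingless tangles *)

Section Join.

Variables (N : nat) (E : seq Defs.arc) (p q r s p' q' r' s' : nat).
Hypothesis labN : {in [:: p; q; r; s; p'; q'; r'; s'], forall l, (l < N)%N}.
Hypothesis labU : uniq [:: p; q; r; s; p'; q'; r'; s'].
Hypothesis labE : {in [:: q; s; p'; r'], forall l, l \notin alabels E}.

Let J := [:: (q, p'); (s, r')].

Ltac labels_tac := rewrite /J /=;
  have /allP/= := labN; split_andb; have /allP/= := labE; split_andb;
  move: labU; rewrite /= !inE !negb_or -!andbA; split_andb.

(** The paths [p]-[q]-[p']-[q'] and [r]-[s]-[r']-[s'] shrink to their end points. *)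
Lemma join_zero_zero :
  loop_weight N ([:: (p', q'); (r', s')] ++ [:: (p, q); (r, s)] ++ J ++ E)
  = loop_weight N [:: (p, q'), (r, s') & E].
Proof.
labels_tac.
contract p q p' ([:: (p', q'); (r', s'); (r, s); (s, r')] ++ E).
contract p p' q' ([:: (r', s'); (r, s); (s, r')] ++ E).
contract r s r' ([:: (r', s'); (p, q')] ++ E).
contract r r' s' ([:: (p, q')] ++ E).
by apply: eq_loop_weight; adj_tac.
Qed.

(** The cap [p']-[r'] is pulled back along the two strands of the left [0] and becomes [p]-[r]. *)
Lemma join_zero_inf :
  loop_weight N ([:: (p', r'); (q', s')] ++ [:: (p, q); (r, s)] ++ J ++ E)
  = loop_weight N [:: (p, r), (q', s') & E].
Proof.
labels_tac.
contract p q p' ([:: (p', r'); (q', s'); (r, s); (s, r')] ++ E).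
contract p p' r' ([:: (q', s'); (r, s); (s, r')] ++ E).
contract p r' s ([:: (q', s'); (r, s)] ++ E).
by contract p s r ([:: (q', s')] ++ E).
Qed.

Lemma join_inf_zero :
  loop_weight N ([:: (p', q'); (r', s')] ++ [:: (p, r); (q, s)] ++ J ++ E)
  = loop_weight N [:: (p, r), (q', s') & E].
Proof.
labels_tac.
contract q' p' q ([:: (r', s'); (p, r); (q, s); (s, r')] ++ E).
contract q' q s ([:: (r', s'); (p, r); (s, r')] ++ E).
contract q' s r' ([:: (r', s'); (p, r)] ++ E).
contract q' r' s' ([:: (p, r)] ++ E).
by apply: eq_loop_weight; adj_tac.
Qed.

(** The four inner corners form a closed loop, whence the factor [loopd]. *)
Lemma join_inf_inf :
  loop_weight N ([:: (p', r'); (q', s')] ++ [:: (p, r); (q, s)] ++ J ++ E)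
  = loopd * loop_weight N [:: (p, r), (q', s') & E].
Proof.
labels_tac.
contract p' q s ([:: (p', r'); (q', s'); (p, r); (s, r')] ++ E).
contract p' s r' ([:: (p', r'); (q', s'); (p, r)] ++ E).
contract p' r' p' ([:: (q', s'); (p, r)] ++ E).
by rewrite (@loop_weight_loop _ ([:: (p, r); (q', s')] ++ E) _ p');
   [ | assumption | notin_tac | adj_tac].
Qed.

End Join.

(** * Gluing two tangles *)

Ltac mem_cases l := let H := fresh in
  move=> H; repeat (case/orP: H => H; first (move/eqP: H => ?; subst l)); 
  first [move/eqP: H => ?; subst l | discriminate H | idtac].

Ltac corner_tac := first [by rewrite ?inE ?eqxx ?orbT | by move=> ?; exfalso; lia].

Section Glue.

Variables (csA csB : seq crossing) (asA asB : seq Defs.arc) (lo mid hi : nat).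
Variables (p q r s p' q' r' s' : nat).
Hypotheses (lo_mid : (lo <= mid)%N) (mid_hi : (mid <= hi)%N).
Hypothesis labA : well_labelled csA asA lo mid p q r s.
Hypothesis labB : well_labelled csB asB mid hi p' q' r' s'.

Let J := [:: (q, p'); (s, r')].

Lemma join_uniq : uniq [:: p; q; r; s; p'; q'; r'; s'].
Proof.
case: labA labB => uA lA [uB lB].
rewrite (cat_uniq [:: p; q; r; s] [:: p'; q'; r'; s']) uA uB andbT.
apply/hasPn => l l4'; apply/negP => l4.
have := lA l; have := lB l; rewrite !mem_cat l4 l4' => /(_ isT) + /(_ isT); lia.
Qed.

Lemma well_labelled_join :
  well_labelled (csA ++ csB) (asA ++ asB ++ J) lo hi p q' r s'.
Proof.
case: labA labB => uA lA [uB lB].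
have cA : all (fun l => (lo <= l < mid)%N) [:: p; q; r; s].
  by apply/allP => l l4; apply: lA; rewrite mem_cat l4.
have cB : all (fun l => (mid <= l < hi)%N) [:: p'; q'; r'; s'].
  by apply/allP => l l4; apply: lB; rewrite mem_cat l4.
rewrite /= in cA cB.
split.
  by have := join_uniq; rewrite /= !inE !negb_or -!andbA; split_andb;
     repeat (apply/andP; split); neq_tac.
have A_hi l : (lo <= l < mid)%N -> (lo <= l < hi)%N by lia.
have B_lo l : (mid <= l < hi)%N -> (lo <= l < hi)%N by lia.
move=> l; rewrite /crlabels map_cat flatten_cat -!/(crlabels _) !alabels_cat !mem_cat.
case/or3P => [l4|/orP[]l4|/or3P[]l4].
- by move: l4; rewrite !inE; mem_cases l; lia.
- by apply/A_hi/lA; rewrite !mem_cat l4 !orbT.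
- by apply/B_lo/lB; rewrite !mem_cat l4 !orbT.
- by apply/A_hi/lA; rewrite !mem_cat l4 !orbT.
- by apply/B_lo/lB; rewrite !mem_cat l4 !orbT.
- by move: l4; rewrite /= !inE orbF -!orbA; mem_cases l; lia.
Qed.

(** Inside each state of the left tangle the right one is replaced by its two crossingless terms. By
    linearity the left one can then be evaluated, and the four crossingless joins give the
    coefficients. *)
Lemma skein_eval_join a b a' b' :
    skein_eval csA asA lo mid p q r s a b ->
    skein_eval csB asB mid hi p' q' r' s' a' b' ->
  skein_eval (csA ++ csB) (asA ++ asB ++ J) lo hi p q' r s'
    (a * a') (a * b' + b * a' + loopd * (b * b')).
Proof.
case: labA labB => uA lA [uB lB] evA evB N E hiN avE.
have cA : all (fun l => (lo <= l < mid)%N) [:: p; q; r; s].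
  by apply/allP => l l4; apply: lA; rewrite mem_cat l4.
have cB : all (fun l => (mid <= l < hi)%N) [:: p'; q'; r'; s'].
  by apply/allP => l l4; apply: lB; rewrite mem_cat l4.
rewrite /= in cA cB.
have midN : (mid <= N)%N by lia.
have lwi := @loop_weight_invariant N; have ssi := state_sum_invariant _ lwi.
pose Z := [:: (p', q'); (r', s')]; pose I := [:: (p', r'); (q', s')].
have evA_with K : K = Z \/ K = I ->
    state_sum csA (loop_weight N) (K ++ asA ++ J ++ E)
    = a * loop_weight N (K ++ [:: (p, q); (r, s)] ++ J ++ E)
      + b * loop_weight N (K ++ [:: (p, r); (q, s)] ++ J ++ E).
  (* The outside of the left tangle now consists of [K], [J] and [E], which meet its range of labels
     only at its corners. *)
  move=> KE; rewrite (ssi _ _ _ (adj_catCA _ _ _)) evA //; last first.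
    move=> l; rewrite !alabels_cat !mem_cat => /or3P[].
    + by case: KE => ->; rewrite /Z /I /alabels /= ?(inE, in_nil, orbF) -?orbA;
         mem_cases l; corner_tac.
    + rewrite /J /alabels /= ?(inE, in_nil, orbF) -?orbA;
         mem_cases l; corner_tac.
    + move=> lE l_lo; have := avE l lE; rewrite !inE => /(_ ltac:(lia)).
      by mem_cases l; move: l_lo; corner_tac.
  by congr (_ * _ + _ * _); apply/eq_loop_weight/(adj_catCA [:: _; _]).
rewrite state_sum_cat.
rewrite (@state_sum_invariant _ _ (ssi csB) _ (asB ++ asA ++ J ++ E)); last first.
  by move=> u v; rewrite -!catA adj_catCA.
rewrite -state_sum_prefix //.
have -> : state_sum csA (fun F => state_sum csB (loop_weight N) (asB ++ F)) (asA ++ J ++ E)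
  = state_sum csA
      (fun F => a' * loop_weight N (Z ++ F) + b' * loop_weight N (I ++ F)) (asA ++ J ++ E).
  (* A state [S] of the left tangle uses only labels below [mid], hence misses the interior of the
     right tangle. *)
  apply: eq_state_sum_on => S SA; apply: evB => // l.
  rewrite !alabels_cat !mem_cat => /or4P[lS|lS|lS|lE] l_midhi.
  + have := lA l; rewrite !mem_cat SA // orbT => /(_ isT); lia.
  + have := lA l; rewrite !mem_cat lS !orbT => /(_ isT); lia.
  + by move: lS l_midhi; rewrite /J /alabels /= ?(inE, in_nil, orbF) -?orbA;
         mem_cases l; corner_tac.
  + have := avE l lE; rewrite !inE => /(_ ltac:(lia)).
    by mem_cases l; move: l_midhi; corner_tac.
rewrite (state_sum_linear csA (fun F => loop_weight N (Z ++ F)) (fun F => loop_weight N (I ++ F))).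
rewrite (state_sum_prefix csA Z _ lwi) (state_sum_prefix csA I _ lwi).
rewrite (evA_with Z (or_introl erefl)) (evA_with I (or_intror erefl)).
have labN : {in [:: p; q; r; s; p'; q'; r'; s'], forall l, (l < N)%N}.
  by apply/allP; move: cA cB; rewrite /=; lia.
have labU : uniq [:: p; q; r; s; p'; q'; r'; s'].
  exact: join_uniq.
(* The inner corners lie in the range of the glued tangle without being corners of it, so [avE]
   excludes them from [E]. *)
have labE : {in [:: q; s; p'; r'], forall l, l \notin alabels E}.
  move=> l l4; apply/negP => lE; have := avE l lE; rewrite !inE.
  have : (lo <= l < hi)%N by move: (l4); rewrite !inE; mem_cases l; lia.
  move=> l_lo /(_ l_lo); move: (labU); rewrite /= !inE !negb_or -!andbA; split_andb.
  by move: l4; rewrite !inE; mem_cases l; apply/negP; rewrite !negb_or;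
     repeat (apply/andP; split); neq_tac.
rewrite (join_zero_zero labN labU labE) (join_zero_inf labN labU labE).
rewrite (join_inf_zero labN labU labE) (join_inf_inf labN labU labE).
have ringid (R : comNzRingType) (x x' y y' d z i : R) :
    x' * (x * z + y * i) + y' * (x * i + y * (d * i))
    = x * x' * z + (x * y' + y * x' + d * (y * y')) * i by ring.
exact: ringid.
Qed.

End Glue.

(** * Tangles and their numerators *)

(** All shifts are included because a product shifts its second factor past the labels of the
    first. *)
Definition tangle_eval (T : tangle) (a b : LF) : Prop :=
  forall n, let T' := tshift n T in
  well_labelled (tcross T') (tarcs T') n (tbnd T') (tnw T') (tne T') (tsw T') (tse T')
  /\ skein_eval (tcross T') (tarcs T') n (tbnd T') (tnw T') (tne T') (tsw T') (tse T') a b.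

Lemma shift_cr_add n m x : shift_cr n (shift_cr m x) = shift_cr (m + n) x.
Proof. by case: x => [[[i j] k] l]; rewrite /= !addnA. Qed.

Lemma shift_arc_add n m x : shift_arc n (shift_arc m x) = shift_arc (m + n) x.
Proof. by case: x => [i j]; rewrite /= !addnA. Qed.

Lemma tshift_add n m T : tshift n (tshift m T) = tshift (m + n) T.
Proof.
by rewrite /tshift /= -!map_comp !addnA (eq_map (shift_cr_add n m)) (eq_map (shift_arc_add n m)).
Qed.

Lemma tshift_tprod n TA TB : tshift n (tprod TA TB) = tprod (tshift n TA) TB.
Proof.
rewrite /tprod [tbnd (tshift n TA)]/= -(tshift_add n (tbnd TA)).
by rewrite {1}/tshift /= !map_cat.
Qed.

Lemma tshift_tvsum n TA TB : tshift n (tvsum TA TB) = tvsum (tshift n TA) TB.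
Proof.
rewrite /tvsum [tbnd (tshift n TA)]/= -(tshift_add n (tbnd TA)).
by rewrite {1}/tshift /= !map_cat.
Qed.

Lemma tangle_eval_tprod TA TB a b a' b' :
    tangle_eval TA a b -> tangle_eval TB a' b' ->
  tangle_eval (tprod TA TB) (a * a') (a * b' + b * a' + loopd * (b * b')).
Proof.
move=> evA evB n T'; rewrite /T' tshift_tprod.
case: (evA n) => labA skA; case: (evB (tbnd (tshift n TA))) => labB skB.
split.
  by apply: (well_labelled_join _ _ labA labB); rewrite /= leq_addl.
by apply: (skein_eval_join _ _ labA labB skA skB); rewrite /= leq_addl.
Qed.

(* Reflecting in the NW-SE diagonal exchanges [0] and [oo] and turns the
   vertical sum into the horizontal product. *)
Lemma tangle_eval_tvsum TA TB a b a' b' :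
    tangle_eval TA a b -> tangle_eval TB a' b' ->
  tangle_eval (tvsum TA TB) (b * a' + a * b' + loopd * (a * a')) (b * b').
Proof.
move=> evA evB n T'; rewrite /T' tshift_tvsum.
case: (evA n) => labA skA; case: (evB (tbnd (tshift n TA))) => labB skB.
have labA' := well_labelledC labA; have labB' := well_labelledC labB.
split.
  apply: well_labelledC.
  by apply: (well_labelled_join _ _ labA' labB'); rewrite /= leq_addl.
apply: skein_evalC.
by apply: (skein_eval_join _ _ labA' labB' (skein_evalC skA) (skein_evalC skB));
   rewrite /= leq_addl.
Qed.

(** The A-smoothing joins SW to SE and NE to NW, which is [0]; the B-smoothing is [oo]. *)
Lemma tangle_eval_tangle1 : tangle_eval tangle1 varA varA^-1.
Proof.
move=> n; split=> /=.
  split; first by rewrite /= !inE !eqn_add2r.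
  by apply/allP; rewrite /= !ltn_add2r !leq_addl.
move=> N E _ _ /=.
congr (_ * _ + _ * _); apply: eq_loop_weight; adj_tac.
Qed.

(** * The Kauffman bracket as an iterated smoothing *)

Lemma state_sum_ffun cs f E : adj_invariant f ->
  state_sum cs f E =
  \sum_(s : {ffun 'I_(size cs) -> bool}) varA ^ ((nA _ s)%:Z - (nB _ s)%:Z)
    * f (E ++ flatten [seq smooth (s i) (nth x0cr cs i) | i <- enum 'I_(size cs)]).
Proof.
move=> finv; elim: cs E => [|x cs IH] E /=.
  rewrite (big_pred1 [ffun=> true]) => [|s]; last first.
    by apply/esym/eqP/ffunP => -[].
  have -> : nA 0 [ffun=> true] = 0%N by rewrite /nA eq_card0 // => -[].
  have -> : nB 0 [ffun=> true] = 0%N by rewrite /nB eq_card0 // => -[].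
  have -> : enum 'I_0 = [::] by apply: size0nil; rewrite size_enum_ord.
  by rewrite subrr expr0z mul1r cats0.
(* A state of [x :: cs] is a choice at [x], stored at index [ord0], together with a state of
   [cs]. *)
pose h (bs : bool * {ffun 'I_(size cs) -> bool}) : {ffun 'I_(size cs).+1 -> bool} :=
  [ffun i => oapp bs.2 bs.1 (unlift ord0 i)].
have h_bij : bijective h.
  exists (fun s : {ffun _ -> bool} => (s ord0, [ffun i => s (lift ord0 i)])).
    move=> [b s]; rewrite /h !ffunE unlift_none /=; congr pair.
    by apply/ffunP => i; rewrite !ffunE liftK.
  move=> s; apply/ffunP => i; rewrite ffunE /=.
  by case: unliftP => [j ->|->] //=; rewrite ffunE.
have h0 b s : h (b, s) ord0 = b by rewrite ffunE unlift_none.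
have hS b s i : h (b, s) (lift ord0 i) = s i by rewrite ffunE liftK.
have nAh b s : nA _ (h (b, s)) = (b + nA _ s)%N.
  rewrite /nA -!sum1_card !(big_mkcond (fun i => i \in _)) big_ord_recl !inE h0.
  by congr (_ + _)%N; apply: eq_bigr => i _; rewrite !inE hS.
have nBh b s : nB _ (h (b, s)) = (~~ b + nB _ s)%N.
  rewrite /nB -!sum1_card !(big_mkcond (fun i => i \in _)) big_ord_recl !inE h0.
  by congr (_ + _)%N; apply: eq_bigr => i _; rewrite !inE hS.
rewrite (reindex h) /=; last exact: onW_bij.
pose F b s := varA ^ ((nA _ (h (b, s)))%:Z - (nB _ (h (b, s)))%:Z)
    * f (E ++ flatten [seq smooth (h (b, s) i) (nth x0cr (x :: cs) i)
                      | i <- enum 'I_(size cs).+1]).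
rewrite (eq_bigr (fun bs => F bs.1 bs.2)); last by case.
rewrite -(pair_bigA _ F) big_bool /=.
have arcs_eq b s : adj (E ++ flatten [seq smooth (h (b, s) i) (nth x0cr (x :: cs) i)
                      | i <- enum 'I_(size cs).+1])
    =2 adj ((smooth b x ++ E) ++ flatten [seq smooth (s i) (nth x0cr cs i)
                      | i <- enum 'I_(size cs)]).
  move=> u v; rewrite enum_ordSl /= h0 -map_comp.
  rewrite -catA adj_catCA; congr (adj (_ ++ _ ++ flatten _) u v).
  by apply: eq_map => i /=; rewrite hS.
rewrite !IH !big_distrr /=; congr (_ + _); apply: eq_bigr => s _; rewrite /F mulrA.
- rewrite (finv _ _ (arcs_eq _ _)) nAh nBh; congr (_ * _).
  by rewrite -{1}(expr1z varA) -expfzDr ?varA_neq0 //; congr (_ ^ _); lia.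
- rewrite (finv _ _ (arcs_eq _ _)) nAh nBh; congr (_ * _).
  by rewrite -{1}(expr1z varA) invr_expz -expfzDr ?varA_neq0 //; congr (_ ^ _); lia.
Qed.

(** Smoothing a crossing keeps its four labels, so every state has the label set of the diagram, and
    [nloops] and [ncomp] count the same components. *)
Lemma kbracket_state_sum D :
  kbracket D = state_sum (dcross D) (loop_weight (dbnd D)) (darcs D).
Proof.
rewrite state_sum_ffun; last exact: loop_weight_invariant.
apply: eq_bigr => s _; congr (_ * _ ^ (_%:Z - 1)).
apply: eq_n_comp_r => l; rewrite !inE /dlabels alabels_cat !mem_cat orbC.
congr (_ || _).
apply/flatten_mapP/flatten_mapP => [[x xD lx]|[a]].
  have iD : (index x (dcross D) < size (dcross D))%N by rewrite index_mem.
  move: lx; rewrite -(smooth_labels (s (Ordinal iD))) => /flatten_mapP[a ax la].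
  exists a => //; apply/flatten_mapP; exists (Ordinal iD); first by rewrite mem_enum.
  by rewrite /= nth_index.
case/flatten_mapP => i _ ai la; exists (nth x0cr (dcross D) i); first exact: mem_nth.
by rewrite -(smooth_labels (s i)); apply/flatten_mapP; exists a.
Qed.

(** The closure of [0] has two loops, of weight [loopd]; that of [oo] has one, of weight 1. *)
Lemma kbracket_numerator T a b :
  tangle_eval T a b -> kbracket (numerator T) = a * loopd + b.
Proof.
move=> /(_ 0%N); rewrite /tshift !addn0.
have -> : map (shift_cr 0) (tcross T) = tcross T.
  by apply: map_id_in => -[[[i j] k] l] _ /=; rewrite !addn0.
have -> : map (shift_arc 0) (tarcs T) = tarcs T.
  by apply: map_id_in => -[i j] _ /=; rewrite !addn0.
case=> /= -[uT lT] ev.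
have cT : all (fun l => (l < tbnd T)%N) [:: tnw T; tne T; tsw T; tse T].
  by apply/allP => l l4; have := lT l; rewrite mem_cat l4 => /(_ isT).
rewrite kbracket_state_sum /=.
move: (tnw T) (tne T) (tsw T) (tse T) cT uT ev {lT} => p q r s.
rewrite /= !inE !negb_or -!andbA; split_andb; split_andb => ev.
rewrite ev //.
have w0 : loop_weight (tbnd T) [::] = loopd^-1.
  rewrite /loop_weight /ncomp (_ : n_comp _ _ = 0%N) //.
  by apply: eq_card0 => l; rewrite !inE andbF.
have d0 := loopd_neq0.
have -> : loop_weight (tbnd T) [:: (p, q); (r, s); (p, q); (r, s)] = loopd.
  contract p q p [:: (r, s); (r, s)].
  rewrite (@loop_weight_loop _ [:: (r, s); (r, s)] _ p); [ | assumption | notin_tac | adj_tac].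
  contract r s r ([::] : seq Defs.arc).
  rewrite (@loop_weight_loop _ [::] _ r); [ | assumption | by [] | adj_tac].
  by rewrite w0 mulfV // mulr1.
have -> : loop_weight (tbnd T) [:: (p, r); (q, s); (p, q); (r, s)] = 1.
  contract p q s [:: (p, r); (r, s)].
  contract p s r [:: (p, r)].
  contract p r p ([::] : seq Defs.arc).
  rewrite (@loop_weight_loop _ [::] _ p); [ | assumption | by [] | adj_tac].
  by rewrite w0 mulfV.
by rewrite mulr1.
Qed.

(** * Congruence modulo I_t *)

Lemma tof_Xn_comp n : tof ('X^n \Po 'X^2) = varA ^+ (2 * n).
Proof. by rewrite comp_Xn_poly -exprM /tof tofracXn. Qed.

Lemma in_ZtM f g : in_Zt f -> in_Zt g -> in_Zt (f * g).
Proof.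
case=> [q [n ->]] [q' [n' ->]]; exists (q * q'), (n + n')%N.
by rewrite comp_polyM /tof tofracM mulnDr exprD invfM mulrACA.
Qed.

Lemma in_ZtD f g : in_Zt f -> in_Zt g -> in_Zt (f + g).
Proof.
case=> [q [n ->]] [q' [n' ->]]; exists (q * 'X^n' + q' * 'X^n), (n + n')%N.
rewrite comp_polyD !comp_polyM /tof tofracD !tofracM -!/(tof _) !tof_Xn_comp.
have idF (F : fieldType) (x y u v : F) : u != 0 -> v != 0 ->
    x / u + y / v = (x * v + y * u) / (u * v) by move=> u0 v0; field; rewrite u0 v0.
rewrite mulnDr exprD; apply: idF; exact: expf_neq0 varA_neq0.
Qed.

Lemma in_ZtN f : in_Zt f -> in_Zt (- f).
Proof.
case=> [q [n ->]]; exists (- q), n.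
by rewrite raddfN /tof tofracN mulNr.
Qed.

Definition monomial_Zt (e : LF) : Prop :=
  exists (eps : bool) (i : int), e = (-1) ^+ eps * tsqrt ^ i.

Lemma tsqrt_neq0 : tsqrt != 0.
Proof. by rewrite /tsqrt expfz_neq0 // varA_neq0. Qed.

Lemma monomial_ZtM e e' : monomial_Zt e -> monomial_Zt e' -> monomial_Zt (e * e').
Proof.
case=> [eps [i ->]] [eps' [i' ->]]; exists (eps (+) eps'), (i + i').
by rewrite signr_addb expfzDr ?tsqrt_neq0 // mulrACA.
Qed.

Lemma monomial_in_Zt e : monomial_Zt e -> in_Zt e.
Proof.
case=> [eps [i ->]].
suff: in_Zt (tsqrt ^ i) by case: eps => [/in_ZtN|]; rewrite ?expr1 ?mulN1r ?expr0 ?mul1r.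
rewrite /tsqrt exprz_exp; case: i => n.
- rewrite (_ : varA ^ (-2 * n%:Z) = 1 / varA ^+ (2 * n)); last first.
    by rewrite mulNr -exprnN div1r.
  by exists 1, n; rewrite -polyC1 comp_polyC /tof tofrac1.
- exists 'X^(n.+1), 0%N; rewrite tof_Xn_comp muln0 expr0 divr1.
  by rewrite NegzE mulrNN -[_ * _]/((2 * n.+1)%N%:Z).
Qed.

Lemma monomial_tsqrt i : monomial_Zt (tsqrt ^ i).
Proof. by exists false, i; rewrite expr0 mul1r. Qed.

Lemma monomial1 : monomial_Zt 1.
Proof. by rewrite -(expr0z tsqrt); apply: monomial_tsqrt. Qed.

Lemma in_Zt1 : in_Zt 1. Proof. exact: monomial_in_Zt monomial1. Qed.

Lemma in_ZtX f n : in_Zt f -> in_Zt (f ^+ n).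
Proof.
move=> fZ; elim: n => [|n IH]; first by rewrite expr0; apply: in_Zt1.
by rewrite exprS; apply: in_ZtM.
Qed.

Lemma doteqI e h f g :
  monomial_Zt e -> in_Zt h -> f = e * g + h * gen_It -> doteq f g.
Proof. by case=> eps [i ->] hZ ->; exists eps, i, h; split => //; rewrite addrC addKr. Qed.

Lemma doteqE f g : doteq f g ->
  exists e h, [/\ monomial_Zt e, in_Zt h & f = e * g + h * gen_It].
Proof.
case=> eps [i [h [hZ fE]]]; exists ((-1) ^+ eps * tsqrt ^ i), h; split=> //.
  by exists eps, i.
by rewrite -fE addrC subrK.
Qed.

Lemma doteq_monomial e f : monomial_Zt e -> doteq (e * f) f.
Proof.
move=> eM; have e0 : e * f = e * f + (1 - 1) * gen_It by rewrite subrr mul0r addr0.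
by apply: doteqI eM _ e0; apply: in_ZtD (in_Zt1) (in_ZtN in_Zt1).
Qed.

Lemma doteq_refl f : doteq f f.
Proof. by rewrite -{1}(mul1r f); apply: doteq_monomial monomial1. Qed.

Lemma doteq_trans f g k : doteq f g -> doteq g k -> doteq f k.
Proof.
move=> /doteqE[e [h [eM hZ ->]]] /doteqE[e' [h' [eM' hZ' ->]]].
apply: (@doteqI (e * e') (e * h' + h)); first exact: monomial_ZtM.
  by apply: in_ZtD hZ; apply: in_ZtM hZ'; apply: monomial_in_Zt.
by rewrite mulrDr !mulrA mulrDl addrA.
Qed.

(** The error term is [(h * f' + e * g * h') * gen_It], whence the two integrality hypotheses. *)
Lemma doteqM f g f' g' :
  in_Zt f' -> in_Zt g -> doteq f g -> doteq f' g' -> doteq (f * f') (g * g').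
Proof.
move=> fZ gZ /doteqE[e [h [eM hZ fE]]] /doteqE[e' [h' [eM' hZ' fE']]].
apply: (@doteqI (e * e') (h * f' + e * g * h')); first exact: monomial_ZtM.
  apply: in_ZtD; apply: in_ZtM => //; apply: in_ZtM => //; exact: monomial_in_Zt.
have idR (R : comNzRingType) (a a' b c c' d k' r : R) :
  r = a' * c' + k' * d -> (a * c + b * d) * r = a * a' * (c * c') + (b * r + a * c * k') * d.
  by move=> ->; ring.
by rewrite {1}fE; apply: idR.
Qed.

Lemma doteqX f g n : in_Zt f -> in_Zt g -> doteq f g -> doteq (f ^+ n) (g ^+ n).
Proof.
move=> fZ gZ fg; elim: n => [|n IH]; first by rewrite !expr0; apply: doteq_refl.
by rewrite !exprS; apply: doteqM => //; apply: in_ZtX.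
Qed.

Lemma tvarE : tvar = varA ^- 4. Proof. by rewrite /tvar -exprnN. Qed.
Lemma tsqrtE : tsqrt = varA ^- 2. Proof. by rewrite /tsqrt -exprnN. Qed.

Lemma monomial_tvar : monomial_Zt tvar.
Proof. by exists false, 2; rewrite expr0 mul1r /tsqrt exprz_exp. Qed.

Lemma in_Zt_tvar : in_Zt tvar. Proof. exact: monomial_in_Zt monomial_tvar. Qed.

Lemma in_Zt_loopd : in_Zt loopd.
Proof.
rewrite /loopd -tsqrtE; apply: in_ZtD; apply: in_ZtN; last first.
  exact: monomial_in_Zt (monomial_tsqrt 1).
rewrite (_ : varA ^+ 2 = tsqrt ^ (-1)); first exact: monomial_in_Zt (monomial_tsqrt _).
by rewrite /tsqrt exprz_exp.
Qed.

(** * Bracket coefficients of [1/2] and [2/5] *)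

Definition coef0_1_2 : LF := - tvar^-1 * (1 - tvar).
Definition coefoo_1_2 : LF := tsqrt.
(** This is [t^-2 - t^-1 + 2 - t], split so that its class modulo I_t is visible. *)
Definition coef0_2_5 : LF := 1 - tvar ^+ 2 + tvar ^- 2 * gen_It.
Definition coefoo_2_5 : LF := tsqrt * (1 - tvar).

Lemma tangle_eval_1_2 : tangle_eval tangle_1_2 coef0_1_2 coefoo_1_2.
Proof.
have := tangle_eval_tvsum tangle_eval_tangle1 tangle_eval_tangle1.
have id0 (F : fieldType) (a : F) : a != 0 ->
    a^-1 * a + a * a^-1 + (- a ^+ 2 - a ^- 2) * (a * a) = - (a ^- 4)^-1 * (1 - a ^- 4).
  by move=> a0; field; rewrite a0 oner_neq0.
rewrite /coef0_1_2 /coefoo_1_2 tvarE tsqrtE /loopd (id0 _ _ varA_neq0).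
by rewrite -invfM -expr2.
Qed.

Lemma tangle_eval_2_5 : tangle_eval tangle_2_5 coef0_2_5 coefoo_2_5.
Proof.
(* The coefficients of [2] simplify to [A^2] and [1 - t]. *)
have ev2 := tangle_eval_tprod tangle_eval_tangle1 tangle_eval_tangle1.
have := tangle_eval_tvsum tangle_eval_1_2 ev2.
have id0 (F : fieldType) (a : F) : a != 0 ->
  let t := a ^- 4 in
  a ^- 2 * (a * a) + (- t^-1 * (1 - t))
     * (a * a^-1 + a^-1 * a + (- a ^+ 2 - a ^- 2) * (a^-1 * a^-1))
   + (- a ^+ 2 - a ^- 2) * ((- t^-1 * (1 - t)) * (a * a))
  = 1 - t ^+ 2 + t ^- 2 * (t ^+ 4 - t ^+ 3 + t ^+ 2 - t + 1).
  by move=> a0 t; rewrite /t; field; rewrite a0 oner_neq0.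
have idoo (F : fieldType) (a : F) : a != 0 ->
  a ^- 2 * (a * a^-1 + a^-1 * a + (- a ^+ 2 - a ^- 2) * (a^-1 * a^-1)) = a ^- 2 * (1 - a ^- 4).
  by move=> a0; field.
rewrite /coef0_2_5 /coefoo_2_5 /coef0_1_2 /coefoo_1_2 /gen_It tvarE tsqrtE /loopd.
by rewrite (id0 _ _ varA_neq0) (idoo _ _ varA_neq0).
Qed.

(** [loopd * coefoo_2_5] is exactly [-(1 - t^2)]; what remains is the Jones polynomial of the
    figure-eight knot. *)
Lemma denominator_2_5 : coef0_2_5 + loopd * coefoo_2_5 = tvar ^- 2 * gen_It.
Proof.
have idF (F : fieldType) (a g : F) : a != 0 ->
   1 - (a ^- 4) ^+ 2 + g + (- a ^+ 2 - a ^- 2) * (a ^- 2 * (1 - a ^- 4)) = g.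
  by move=> a0; field.
rewrite /coef0_2_5 /coefoo_2_5; move: (tvar ^- 2 * gen_It) => g.
by rewrite tvarE tsqrtE /loopd (idF _ _ _ varA_neq0).
Qed.

Lemma in_Zt0 : in_Zt 0.
Proof. by rewrite -(subrr 1); apply: in_ZtD in_Zt1 (in_ZtN in_Zt1). Qed.

Lemma in_Zt_tvarV n : in_Zt (tvar ^- n).
Proof.
rewrite -exprVn; apply/in_ZtX/monomial_in_Zt.
by exists false, (-2); rewrite expr0 mul1r /tsqrt exprz_exp /tvar invr_expz.
Qed.

Lemma in_Zt_gen : in_Zt gen_It.
Proof.
rewrite /gen_It; do 4 (apply: in_ZtD; last by
  [exact: in_Zt1 | exact: in_Zt_tvar | apply: in_ZtN; exact: in_Zt_tvar
  | exact: in_ZtX in_Zt_tvar | apply: in_ZtN; exact: in_ZtX in_Zt_tvar]).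
exact: in_ZtX in_Zt_tvar.
Qed.

Lemma in_Zt_1_tvarX n : in_Zt (1 - tvar ^+ n).
Proof. exact: in_ZtD in_Zt1 (in_ZtN (in_ZtX _ in_Zt_tvar)). Qed.

Lemma in_Zt_1_tvar : in_Zt (1 - tvar).
Proof. exact: in_Zt_1_tvarX 1. Qed.

Lemma in_Zt_coef0_1_2 : in_Zt coef0_1_2.
Proof.
apply: in_ZtM in_Zt_1_tvar; apply: in_ZtN.
exact: in_Zt_tvarV 1.
Qed.

Lemma in_Zt_coef0_2_5 : in_Zt coef0_2_5.
Proof.
apply: in_ZtD; first exact: in_Zt_1_tvarX.
exact: in_ZtM (in_Zt_tvarV 2) in_Zt_gen.
Qed.

Lemma in_Zt_coefoo_2_5 : in_Zt coefoo_2_5.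
Proof. exact: in_ZtM (monomial_in_Zt (monomial_tsqrt 1)) in_Zt_1_tvar. Qed.

(* As the denominator closure of [2/5] vanishes mod I_t, a product having a
   factor [2/5] evaluates mod I_t to [2/5] times a scalar [r]. *)
Definition eval_as_2_5 (T : tangle) (r : LF) : Prop :=
  exists2 h, in_Zt h
    & tangle_eval T (coef0_2_5 * r) (coefoo_2_5 * r + h * gen_It).

(** In the second coefficient the two main terms containing [b] combine to [r * b] times the
    denominator bracket of [2/5], a multiple of [gen_It]; only [coefoo_2_5 * r * a] survives. *)
Lemma eval_as_2_5_tprod T r T' a b :
    in_Zt r -> in_Zt a -> in_Zt b -> eval_as_2_5 T r -> tangle_eval T' a b ->
  eval_as_2_5 (tprod T T') (r * a).
Proof.
move=> rZ aZ bZ [h hZ ev] ev'.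
(* The first term comes from the denominator bracket, the other two carry the old error [h] through
   the product formula. *)
exists (r * b * tvar ^- 2 + h * a + loopd * h * b).
  apply: in_ZtD; last by apply: in_ZtM bZ; apply: in_ZtM hZ; apply: in_Zt_loopd.
  apply: in_ZtD; last exact: in_ZtM.
  by apply: in_ZtM (in_Zt_tvarV 2); apply: in_ZtM.
have := tangle_eval_tprod ev ev'.
have id2 (R : comNzRingType) (x y a' b' d g k u v : R) : x + d * y = u * g ->
  x * v * b' + (y * v + k * g) * a' + d * ((y * v + k * g) * b')
  = y * (v * a') + (v * b' * u + k * a' + d * k * b') * g.
  by move=> /(canRL (addrK _)) ->; ring.
by rewrite -mulrA (id2 _ _ _ _ _ _ _ _ _ _ denominator_2_5).
Qed.

Lemma eval_as_2_5_nseq T r T' a b n :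
    in_Zt r -> in_Zt a -> in_Zt b -> eval_as_2_5 T r -> tangle_eval T' a b ->
  eval_as_2_5 (foldl tprod T (nseq n T')) (r * a ^+ n).
Proof.
move=> + aZ bZ + ev'; elim: n T r => [|n IH] T r rZ ev /=; first by rewrite expr0 mulr1.
rewrite exprS mulrA; apply: IH; first exact: in_ZtM.
exact: eval_as_2_5_tprod ev ev'.
Qed.

Lemma eval_as_2_5_montesinos k m :
  eval_as_2_5 (tprod_seq (nseq k.+1 tangle_2_5 ++ nseq m tangle_1_2))
              (coef0_2_5 ^+ k * coef0_1_2 ^+ m).
Proof.
rewrite /= foldl_cat; apply: eval_as_2_5_nseq tangle_eval_1_2.
- exact: in_ZtX in_Zt_coef0_2_5.
- exact: in_Zt_coef0_1_2.
- exact: monomial_in_Zt (monomial_tsqrt 1).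
(* The leading [2/5] starts the product with scalar 1 and error 0; the other [k] copies multiply the
   scalar. *)
rewrite -[_ ^+ k]mul1r; apply: eval_as_2_5_nseq tangle_eval_2_5.
- exact: in_Zt1.
- exact: in_Zt_coef0_2_5.
- exact: in_Zt_coefoo_2_5.
exists 0; first exact: in_Zt0.
rewrite !mulr1 mul0r addr0; exact: tangle_eval_2_5.
Qed.

(** * Residue classes of the coefficients and of the bracket *)

Lemma doteq_numerator_2_5 : doteq (coef0_2_5 * loopd + coefoo_2_5) (1 + tvar ^+ 2).
Proof.
have idF (F : fieldType) (a : F) : a != 0 -> let t := a ^- 4 in
  (1 - t ^+ 2 + t ^- 2 * (t ^+ 4 - t ^+ 3 + t ^+ 2 - t + 1)) * (- a ^+ 2 - a ^- 2)
    + a ^- 2 * (1 - t) = - a ^+ 10 * (1 + t ^+ 2).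
  by move=> a0 t; rewrite /t; field; rewrite a0 oner_neq0.
rewrite /coef0_2_5 /coefoo_2_5 /gen_It tsqrtE tvarE /loopd (idF _ _ varA_neq0).
(* The unit is [-A^10], and [A^10 = t^(-5/2)]. *)
apply: doteq_monomial; exists true, (-5).
by rewrite expr1 mulN1r /tsqrt exprz_exp.
Qed.

Lemma doteq_coef0_2_5 : doteq coef0_2_5 (1 - tvar ^+ 2).
Proof. by apply: (doteqI monomial1 (in_Zt_tvarV 2)); rewrite mul1r. Qed.

Lemma doteq_coef0_1_2 : doteq coef0_1_2 (1 - tvar).
Proof.
apply: doteq_monomial; exists true, (-2).
by rewrite expr1 mulN1r /tsqrt exprz_exp /tvar invr_expz.
Qed.

Lemma doteq_kbracket_montesinos k m :
  doteq (kbracket (montesinos_2_5_1_2 k.+1 m))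
        ((1 + tvar ^+ 2) * (1 - tvar ^+ 2) ^+ k * (1 - tvar) ^+ m).
Proof.
have [h hZ /kbracket_numerator ->] := eval_as_2_5_montesinos k m.
set r := _ ^+ k * _.
have idR (R : comNzRingType) (x y z d k' g : R) :
  x * z * d + (y * z + k' * g) = (x * d + y) * z + k' * g by ring.
rewrite idR -mulrA.
have rZ : in_Zt r.
  by apply: in_ZtM; apply: in_ZtX; [apply: in_Zt_coef0_2_5|apply: in_Zt_coef0_1_2].
have /doteqE[e [h' [eM hZ' ->]]] : doteq ((coef0_2_5 * loopd + coefoo_2_5) * r)
    ((1 + tvar ^+ 2) * ((1 - tvar ^+ 2) ^+ k * (1 - tvar) ^+ m)).
  apply: doteqM => //.
  - exact: in_ZtD in_Zt1 (in_ZtX _ in_Zt_tvar).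
  - exact: doteq_numerator_2_5.
  apply: doteqM.
  - exact: in_ZtX in_Zt_coef0_1_2.
  - exact: in_ZtX (in_Zt_1_tvarX 2).
  - exact: doteqX in_Zt_coef0_2_5 (in_Zt_1_tvarX 2) doteq_coef0_2_5.
  - exact: doteqX in_Zt_coef0_1_2 in_Zt_1_tvar doteq_coef0_1_2.
rewrite -addrA -mulrDl; apply: (doteqI eM) (erefl _); exact: in_ZtD.
Qed.

(** * Parity of the crossing number and the writhe factor *)

Lemma odd_size_tprod_seq T ts :
    ~~ odd (size (tcross T)) -> all (fun T => ~~ odd (size (tcross T))) ts ->
  ~~ odd (size (tcross (foldl tprod T ts))).
Proof.
elim: ts T => //= T' ts IH T oT /andP[oT' ots]; apply: IH => //.
by rewrite size_cat size_map oddD (negPf oT) (negPf oT').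
Qed.

(** Each sign is 1 minus 0 or 2, so the writhe has the parity of the crossing number. *)
Lemma writheE D O : writhe D O =
  (size (dcross D))%:Z - 2 * \sum_(i < size (dcross D))
     ((nth (true, true) (ocross O) i).1 == (nth (true, true) (ocross O) i).2)%:Z.
Proof.
rewrite mulr_sumr (_ : (size _)%:Z = \sum_(i < size (dcross D)) 1); last first.
  by rewrite sumr_const card_ord natz.
rewrite -sumrB.
by apply: eq_bigr => i _; rewrite /cr_sign; case: (_ == _).
Qed.

Lemma doteq_jones D O : ~~ odd (size (dcross D)) -> doteq (jones D O) (kbracket D).
Proof.
move=> oD; apply: doteq_monomial.
rewrite writheE; set S := \sum_(i < _) _.
have -> : - ((size (dcross D))%:Z - 2 * S) = -2 * ((size (dcross D))./2%:Z - S) by lia.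
(* [(-A^3)^(-2) = A^(-6) = t^(3/2)], whence the factor 3. *)
exists false, (3 * ((size (dcross D))./2%:Z - S)).
rewrite expr0 mul1r -(exprz_exp _ (-2)) -(exprz_exp _ 3); congr (_ ^ _).
have sqF (F : fieldType) (a : F) : (- a ^+ 3) ^- 2 = a ^- 6 by rewrite sqrrN -exprM.
by rewrite /tsqrt exprz_exp; apply: sqF.
Qed.

Lemma doteq_1_tvar2_1_tvar : doteq ((1 + tvar ^+ 2) * (1 - tvar)) 1.
Proof.
apply: (@doteqI (- tvar ^+ 4) 1); last 1 first.
- have idR (R : comNzRingType) (t : R) :
    (1 + t ^+ 2) * (1 - t) = - t ^+ 4 * 1 + 1 * (t ^+ 4 - t ^+ 3 + t ^+ 2 - t + 1) by ring.
  exact: idR.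
(* [t^4] is the eighth power of [tsqrt]. *)
- exists true, 8; by rewrite expr1 mulN1r /tsqrt exprz_exp /tvar -[tvar ^+ 4]/(_ ^ 4) exprz_exp.
- exact: in_Zt1.
Qed.

Unset Implicit Arguments.
Set Strict Implicit.

Theorem theorem5p7 (k m : nat) (hk : (1 <= k)%N) (O : orientation)
  (hO : valid_orientation (montesinos_2_5_1_2 k m) O) :
  doteq (jones (montesinos_2_5_1_2 k m) O)
        ((1 + tvar ^+ 2) * (1 - tvar ^+ 2) ^+ (k - 1) * (1 - tvar) ^+ m)
  /\ ((2 <= k + m)%N ->
      doteq (jones (montesinos_2_5_1_2 k m) O)
            ((1 + tvar) ^+ (k - 1) * (1 - tvar) ^+ (k + m - 2))).
Proof.
case: k hk hO => // k _ _; rewrite subn1 [k.+1.-1]/=.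
have odd_cr : ~~ odd (size (dcross (montesinos_2_5_1_2 k.+1 m))).
  by rewrite /=; apply: odd_size_tprod_seq => //; rewrite all_cat !all_nseq !orbT.
have part1 := doteq_trans (doteq_jones O odd_cr) (doteq_kbracket_montesinos k m).
split=> // km2; apply: doteq_trans part1 _.
(* Here [k] is one less than in the statement, so the bound gives [k + m >= 1]. *)
have [n kmE] : exists n, (k + m = n.+1)%N by exists (k + m).-1; lia.
have -> : (k.+1 + m - 2 = n)%N by lia.
(* Factoring [1 - t^2] yields [k + m = n + 1] factors [1 - t]; one of them is set aside to turn
   [1 + t^2] into a unit modulo I_t. *)
have -> : (1 + tvar ^+ 2) * (1 - tvar ^+ 2) ^+ k * (1 - tvar) ^+ m
    = (1 + tvar ^+ 2) * (1 - tvar) * ((1 + tvar) ^+ k * (1 - tvar) ^+ n).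
  have -> : 1 - tvar ^+ 2 = (1 - tvar) * (1 + tvar) by rewrite -subr_sqr expr1n.
  rewrite exprMn -[RHS]mulrA; rewrite (mulrCA (1 - tvar)) -exprS -kmE exprD.
  by rewrite (mulrC (_ ^+ k)) -!mulrA.
rewrite -[X in doteq _ X]mul1r; apply: doteqM.
- apply: in_ZtM; apply: in_ZtX; last exact: in_Zt_1_tvar.
  exact: in_ZtD in_Zt1 in_Zt_tvar.
- exact: in_Zt1.
- exact: doteq_1_tvar2_1_tvar.
- exact: doteq_refl.
Qed.
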